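(* Let $X$ be a random variable having one of the following four laws, with mass function $P(k)=\Pr\{X=k\}$ and mean $\mu$: (1) binomial $\mathrm{Bin}(N,p)$, $N\ge 1$ an integer, $0<p<1$, $q=1-p$; (2) Poisson $\mathrm{Poi}(\lambda)$, $\lambda>0$ real; (3) negative binomial $\mathrm{NB}(r,p)$, $r>0$ real, $0<p<1$, $q=1-p$; (4) hypergeometric $\mathrm{Hyp}(N,K,n)$ with integers $1\le K\le N-1$, $1\le n\le N-1$. Define, respectively, $$g(k)=kq,\qquad g(k)=k,\qquad g(k)=\frac{k}{p},\qquad g(k)=\frac{k\,(k+N-K-n)}{N}.$$ Then in each of the four cases $$(k-\mu)P(k)=g(k)P(k)-g(k+1)P(k+1)\qquad\text{for all integers }k\ge 0,$$ and consequently, for every integer $\nu\ge 0$, $$\sum_{k\ge\nu}(k-\mu)P(k)=g(\nu)P(\nu).$$ In particular, with $\nu=\lceil\mu\rceil$, $$\mathbb E|X-\mu|=2\,g(\nu)\,P(\nu).$$ When $\mu\in\mathbb Z$, the choices $\nu=\mu$ and $\nu=\mu+1$ give the same value of $2g(\nu)P(\nu)$ (namely $\mathbb E|X-\mu|$).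
   Context: Conventions for the laws. Binomial: $P(k)=\binom Nk p^kq^{N-k}$, $\mu=Np$. Poisson: $P(k)=e^{-\lambda}\lambda^k/k!$, $\mu=\lambda$. Negative binomial (counting failures, $r>0$ real): $P(k)=\binom{k+r-1}{k}p^rq^k=\frac{\Gamma(k+r)}{\Gamma(r)\Gamma(k+1)}p^rq^k$ for integers $k\ge0$, $\mu=rq/p$. Hypergeometric: $P(k)=\binom Kk\binom{N-K}{n-k}/\binom Nn$, with binomial coefficients $\binom{m}{j}=0$ for $j<0$ or $j>m$, $\mu=nK/N$. In all cases $P(k)=0$ for integers $k$ outside the support. *)

(* Defs.v *)
From mathcomp Require Import all_boot all_order all_algebra.
From mathcomp Require Import all_classical all_reals all_analysis.

Set Implicit Arguments.
Unset Strict Implicit.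
Unset Printing Implicit Defensive.

Import Order.TTheory GRing.Theory Num.Theory.
Import numFieldNormedType.Exports.

Local Open Scope ring_scope.

(* Binomial coefficient with integer lower index, equal to 0 for j < 0 or
   j > m. Truncated subtraction in 'C(m, n - k) would give 1 when k > n. *)
Definition binz (m : nat) (j : int) : nat :=
  if j is Posz i then 'C(m, i) else 0%N.

(* x (x - 1) ... (x - k + 1) / k`!, the binomial coefficient with a real upper
   index; for x = k + r - 1 it is Gamma (k + r) / (Gamma r * Gamma (k + 1)). *)
Definition binr (R : realType) (x : R) (k : nat) : R :=
  (\prod_(i < k) (x - i%:R)) / k`!%:R.

Variant law (R : realType) : Type :=
  | Binomial of nat & R                   (* N, p *)
  | Poisson of R                          (* lambda *)
  | NegBinomial of R & R                  (* r, p: counts the failures *)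
  | Hypergeometric of nat & nat & nat.    (* N, K, n *)

Definition law_valid (R : realType) (L : law R) : Prop :=
  match L with
  | Binomial N p => (1 <= N)%N /\ 0 < p < 1
  | Poisson lambda => 0 < lambda
  | NegBinomial r p => 0 < r /\ 0 < p < 1
  | Hypergeometric N K n => (1 <= K <= N - 1)%N /\ (1 <= n <= N - 1)%N
  end.

Definition law_pmf (R : realType) (L : law R) (k : int) : R :=
  if k is Posz j then
    match L with
    | Binomial N p => binomial_pmf N p j
    | Poisson lambda => poisson_pmf lambda j
    | NegBinomial r p => binr (j%:R + r - 1) j * (p `^ r) * (1 - p) ^+ j
    | Hypergeometric N K n =>
        'C(K, j)%:R * (binz (N - K) (n%:Z - j%:Z))%:R / 'C(N, n)%:R
    end
  else 0.

Definition law_mean (R : realType) (L : law R) : R :=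
  match L with
  | Binomial N p => N%:R * p
  | Poisson lambda => lambda
  | NegBinomial r p => r * (1 - p) / p
  | Hypergeometric N K n => n%:R * K%:R / N%:R
  end.

Definition law_g (R : realType) (L : law R) (k : int) : R :=
  match L with
  | Binomial N p => k%:~R * (1 - p)
  | Poisson lambda => k%:~R
  | NegBinomial r p => k%:~R / p
  | Hypergeometric N K n =>
      (k * (k + N%:Z - K%:Z - n%:Z))%:~R / N%:R
  end.

(* Main.v *)
Require Import Defs.
From mathcomp Require Import all_boot all_order all_algebra.
From mathcomp Require Import all_classical all_reals all_analysis.
From mathcomp Require Import ring lra zify.
Import Order.TTheory GRing.Theory Num.Theory.
Import numFieldNormedType.Exports.
Local Open Scope classical_set_scope.
Local Open Scope ring_scope.

(* In every case g(k+1) P(k+1) = (g(k) - k + mu) P(k), so the sum of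
   (k - mu) P(k) over nu <= k < n telescopes to g(nu) P(nu) - g(n) P(n). The last
   term tends to 0 because the ratio of consecutive values of g P is eventually
   below some c < 1 (the hypergeometric law has finite support instead). Only the
   masses at the integers are given: that they add up to 1, so that X is almost
   surely a natural number, is Newton's binomial theorem, the exponential series,
   the binomial series with exponent -r and Vandermonde's identity. *)

(** * Mass functions and their one-step recursion *)

(** Reversing the order of the factors gives the rising factorial of r, from which positivity and
    the recursion in k can be read off. *)
Lemma binr_rising (R : realType) (r : R) k :
  binr (k%:R + r - 1) k = \prod_(i < k) (r + i%:R) / k`!%:R.
Proof.
congr (_ / _); rewrite (reindex_inj rev_ord_inj); apply: eq_bigr => i _ /=.
rewrite natrB //; first by rewrite -(natr1 i); ring.
Qed.

Lemma binr_risingS (R : realType) (r : R) k :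
  k.+1%:R * binr (k.+1%:R + r - 1) k.+1 =
  (r + k%:R) * binr (k%:R + r - 1) k.
Proof.
rewrite !binr_rising big_ord_recr /= factS natrM.
have k0 : (k.+1%:R : R) != 0 by rewrite pnatr_eq0.
have f0 : (k`!%:R : R) != 0 by rewrite pnatr_eq0 -lt0n fact_gt0.
by field; apply/andP; split.
Qed.

Lemma binr_rising_gt0 (R : realType) (r : R) k :
  0 < r -> 0 < binr (k%:R + r - 1) k.
Proof.
move=> r0; rewrite binr_rising divr_gt0 ?ltr0n ?fact_gt0 //.
by apply: prodr_gt0 => i _; rewrite ltr_wpDr.
Qed.

Lemma law_pmf_ge0 (R : realType) (L : law R) (k : int) :
  law_valid L -> 0 <= law_pmf L k.
Proof.
case: k => // k; case: L => [N p [_ /andP[/ltW p0 /ltW p1]]|l _|r p|N K n _] /=.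
- by apply: binomial_pmf_ge0; rewrite p0 p1.
- exact: poisson_pmf_ge0.
- move=> [r0 /andP[_ /ltW p1]]; have /ltW c0 := binr_rising_gt0 R r k r0.
  by apply: mulr_ge0 (mulr_ge0 c0 (powR_ge0 _ _)) _; rewrite exprn_ge0 ?subr_ge0.
- by rewrite divr_ge0 // mulr_ge0.
Qed.

Lemma natr_mul_binS (R : realType) m k :
  (k.+1%:R * 'C(m, k.+1)%:R = (m%:R - k%:R) * 'C(m, k)%:R :> R).
Proof.
rewrite -natrM mul_bin_left natrM.
have [km|mk] := leqP k m; first by rewrite natrB.
by rewrite (bin_small mk) !mulr0.
Qed.

(** For k < n this is (m - j) C(m, j) = (j + 1) C(m, j + 1) with j = n - k - 1. At k = n the factor
    n - k vanishes and the left index is -1; beyond n both lower indices are negative. *)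
Lemma natr_binzB (R : realType) m n k :
  (m%:R - n%:R + k.+1%:R) * (binz m (n%:Z - k.+1%:Z))%:R =
  (n%:R - k%:R) * (binz m (n%:Z - k%:Z))%:R :> R.
Proof.
have [kn|] := ltnP k n.
  rewrite !subzn // ?[(k <= n)%N]ltnW //=.
  have -> : (n - k = (n - k.+1).+1)%N by lia.
  have := natr_mul_binS R m (n - k.+1).
  rewrite -natr1 natrB // -!natr1 => e.
  rewrite (_ : n%:R - k%:R = n%:R - (k%:R + 1) + 1 :> R); last by ring.
  by rewrite e; ring.
rewrite leq_eqVlt => /orP[/eqP->|nk].
  rewrite subrr mul0r (_ : k%:Z - k.+1%:Z = Negz 0) ?mulr0 //; lia.
rewrite (_ : n%:Z - k.+1%:Z = Negz (k - n)); last by lia.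
by rewrite (_ : n%:Z - k%:Z = Negz (k - n).-1) ?mulr0 //; lia.
Qed.

(** The factor g(k) - k + mu is (N - k) p, lambda, (r + k) (1 - p) / p and (K - k) (n - k) / N in
    the four cases, which is what the ratio of consecutive masses produces. *)
Lemma law_g_pmfS (R : realType) (L : law R) (k : nat) : law_valid L ->
  law_g L k.+1%:Z * law_pmf L k.+1%:Z =
  (law_g L k%:Z - k%:R + law_mean L) * law_pmf L k%:Z.
Proof.
case: L => [N p [_ /andP[p0 p1]]|l l0|r p [r0 /andP[p0 p1]]|N K n] /=.
- have [kN|Nk] := ltnP k N; last first.
    rewrite /binomial_pmf bin_small // mulr0n mulr0.
    (* At k = N the mass is nonzero in general but the factor (N - k) p vanishes; beyond N both
       masses are 0. *)
    move: Nk; rewrite leq_eqVlt => /orP[/eqP->|Nk].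
      by rewrite -pmulrn; ring.
    by rewrite bin_small // mulr0n mulr0.
  have NkE : (N - k = (N - k.+1).+1)%N by lia.
  rewrite /binomial_pmf -(mulr_natr _ 'C(_, k.+1)) -(mulr_natr _ 'C(_, k)).
  rewrite NkE !exprS -!pmulrn /unstable.onem.
  transitivity (p * p ^+ k * (1 - p) * (1 - p) ^+ (N - k.+1) *
                (k.+1%:R * 'C(N, k.+1)%:R)); first by ring.
  by rewrite natr_mul_binS; ring.
- rewrite /poisson_pmf l0 -!pmulrn factS natrM exprS.
  have k0 : (k.+1%:R : R) != 0 by rewrite pnatr_eq0.
  have f0 : (k`!%:R : R) != 0 by rewrite pnatr_eq0 -lt0n fact_gt0.
  by field; apply/andP; split.
- rewrite -!pmulrn exprS.
  transitivity (k.+1%:R * binr (k.+1%:R + r - 1) k.+1 / p * p `^ r *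
                ((1 - p) * (1 - p) ^+ k)); first by ring.
  by rewrite binr_risingS; field; rewrite gt_eqF.
- move=> [/andP[K0 KN] /andP[n0 nN]].
  have N0 : (N%:R : R) != 0 by rewrite pnatr_eq0; lia.
  have C0 : ('C(N, n)%:R : R) != 0.
    by rewrite pnatr_eq0 -lt0n bin_gt0; lia.
  rewrite !intrM !intrD !intrN -!pmulrn.
  have e := natr_binzB R (N - K) n k.
  rewrite natrB in e; last by lia.
  transitivity (k.+1%:R * 'C(K, k.+1)%:R *
     ((N%:R - K%:R - n%:R + k.+1%:R) * (binz (N - K) (n%:Z - k.+1%:Z))%:R)
     / N%:R / 'C(N, n)%:R : R).
    by ring.
  rewrite e natr_mul_binS; field; exact/andP.
Qed.

(** * Decay of the boundary term g(n) P(n) *)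

Lemma cvg0_le_ratio (R : realType) (u : R^nat) (c : R) (N : nat) :
  0 <= c < 1 -> (forall n, (N <= n)%N -> 0 <= u n) ->
  (forall n, (N <= n)%N -> u n.+1 <= c * u n) -> u @ \oo --> 0.
Proof.
move=> /andP[c0 c1] u0 uc.
rewrite -(cvg_shiftn N).
have cg : geometric (u N) c n @[n --> \oo] --> 0.
  by apply: cvg_geometric; rewrite ger0_norm.
apply: squeeze_cvgr (cvg_cst 0) cg.
apply: nearW => n /=; rewrite u0 ?leq_addl //=.
elim: n => [|n IHn]; first by rewrite expr0 mulr1.
rewrite addSn (le_trans (uc _ _)) ?leq_addl //.
by rewrite exprS mulrCA ler_wpM2l.
Qed.

(** Common to the three laws with g(k) = k / a, where a is 1 / (1 - p), 1 or p. The ratio of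
    consecutive terms is 1 - a + a mu / k, at most 1 - a / 2 once k >= 2 mu. *)
Lemma cvg0_linear_weight (R : realType) (p : R^nat) (a mu : R) :
  0 < a -> (forall k, 0 <= p k) ->
  (forall k, k.+1%:R / a * p k.+1 = (k%:R / a - k%:R + mu) * p k) ->
  (fun k => k%:R / a * p k) @ \oo --> 0.
Proof.
move=> a0 p0 pS.
pose N := (Num.truncn (2 * mu)).+1.
(* The maximum with 0 is for a > 2, where 1 - a / 2 is negative. *)
apply: (@cvg0_le_ratio _ _ (Num.max 0 (1 - a / 2)) N).
- by rewrite le_max lexx gt_max ltr01 /=; lra.
- by move=> n _; rewrite mulr_ge0 // divr_ge0 // ltW.
move=> n Nn; rewrite pS.
have mun : mu <= n%:R / 2.
  have : 2 * mu < N%:R by rewrite truncnS_gt.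
  have : (N%:R : R) <= n%:R by rewrite ler_nat.
  by lra.
rewrite mulrA ler_wpM2r //.
apply: (@le_trans _ _ ((1 - a / 2) * (n%:R / a))); last first.
  by rewrite ler_wpM2r ?le_max ?lexx ?orbT // divr_ge0 // ltW.
rewrite (_ : (1 - a / 2) * _ = n%:R / a - n%:R / 2).
  by move: (n%:R / a) => x; lra.
by field; rewrite gt_eqF.
Qed.

Lemma cvg_eventually_eq (R : realType) (u : R^nat) (l : R) (N : nat) :
  (forall n, (N <= n)%N -> u n = l) -> u @ \oo --> l.
Proof.
move=> uN; apply: (@cvg_trans _ (cst l @ \oo)); last exact: cvg_cst.
by apply: near_eq_cvg; exists N => // n /= Nn; rewrite uN.
Qed.

Lemma law_g_pmf_cvg0 (R : realType) (L : law R) : law_valid L ->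
  (fun k : nat => law_g L k%:Z * law_pmf L k%:Z) @ \oo --> 0.
Proof.
case: L => [N p|l|r p|N K n] hL.
- have [_ /andP[p0 p1]] := hL.
  under eq_fun do rewrite /law_g -pmulrn -[1 - p]invrK.
  apply: cvg0_linear_weight => [|k|k]; first by rewrite invr_gt0 subr_gt0.
    exact: law_pmf_ge0.
  by have := law_g_pmfS R _ k hL; rewrite /law_g -!pmulrn invrK; apply.
- under eq_fun do rewrite /law_g -pmulrn -[_%:R]divr1.
  apply: cvg0_linear_weight => // [k|k]; first exact: law_pmf_ge0.
  by have := law_g_pmfS R _ k hL; rewrite /law_g -!pmulrn !divr1; apply.
- have [_ /andP[p0 p1]] := hL.
  apply: cvg0_linear_weight => // [k|k]; first exact: law_pmf_ge0.
  by have := law_g_pmfS R _ k hL; rewrite /law_g -!pmulrn; apply.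
- apply: (@cvg_eventually_eq _ _ _ K.+1) => k Kk.
  by rewrite /= bin_small // !mul0r mulr0.
Qed.

(** * Total mass one *)

(** The full series solves S' (1 - t) = r S, the equation of (1 - t)^(-r); truncation leaves one
    boundary term. At n = 0 the value of [n.-1] is harmless, since the factor n is 0. *)
Lemma deriv_poly_rising (R : realType) (r t : R) (c : R^nat) (n : nat) :
  (forall k, k.+1%:R * c k.+1 = (r + k%:R) * c k) ->
  let S := \sum_(k < n) c k *: 'X^k in
  S^`().[t] * (1 - t) = r * S.[t] - n%:R * c n * t ^+ n.-1.
Proof.
move=> cS; elim: n => [|n IHn] /=; first by rewrite big_ord0 deriv0 !horner0; ring.
rewrite big_ord_recr /= derivD derivZ derivXn !hornerE mulrDl IHn.
rewrite hornerMn !hornerE cS -mulr_natr.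
by case: n {IHn} => [|n] /=; rewrite ?exprS; ring.
Qed.

(* By the mean value theorem on [0, 1 - p] for S(t) (1 - t)^r, S the partial sum
   of the binomial series of (1 - t)^(-r): its derivative telescopes to the
   single term - (n c_n) t^(n-1) (1 - t)^(r-1). *)
Lemma negbinomial_partial_mass (R : realType) (r p : R) (n : nat) :
  0 < r -> 0 < p < 1 ->
  `|1 - \sum_(k < n.+1) law_pmf (NegBinomial r p) k%:Z| <=
  law_g (NegBinomial r p) n.+1%:Z * law_pmf (NegBinomial r p) n.+1%:Z / p `^ r.
Proof.
move=> r0 /andP[p0 p1].
pose c k := binr (k%:R + r - 1) k.
pose S : {poly R} := \sum_(k < n.+1) c k *: 'X^k.
pose F : R -> R := fun t => S.[t] * (1 - t) `^ r.
pose f (t : R) := - (n.+1%:R * c n.+1 * t ^+ n) * (1 - t) `^ (r - 1).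
have F' (t : R) : t < 1 -> is_derive t (1 : R) F (f t).
  move=> t1.
  have t1' : 0 < 1 - t by rewrite subr_gt0.
  have d1 : is_derive t (1 : R) (fun t => 1 - t) (-1).
    by rewrite -[X in is_derive _ _ _ X]sub0r; apply: is_deriveB.
  have d2 := @is_derive1_comp R (fun x => x `^ r) (fun t => 1 - t) _ _ _
    (@is_derive1_powR _ r _ t1') d1.
  have d3 := is_deriveM (is_derive_poly S t) d2.
  apply: (is_derive_eq d3).
  have e := deriv_poly_rising R r t c n.+1 (binr_risingS R r).
  rewrite /= -/S in e.
  rewrite /f /c /GRing.scale /= -(mulr_powRB1 (ltW t1') r0).
  have alg (a b x y z : R) : x * b = r * y - z ->
      y * (r * a * -1) + b * a * x = - z * a.
    move=> xb; transitivity (a * (x * b - r * y)); first by ring.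
    by rewrite xb; ring.
  exact: alg e.
have [t] : exists2 t, t \in `]0, 1 - p[ & F (1 - p) - F 0 = f t * (1 - p - 0).
  apply: MVT; first by rewrite subr_gt0.
    by move=> t; rewrite in_itv /= => /andP[_ tp]; apply: F'; lra.
  apply: derivable_within_continuous => t; rewrite in_itv /= => /andP[_ tp].
  by apply: (@ex_derive _ _ _ _ _ _ (f t)); apply: F'; lra.
rewrite in_itv /= subr0 => /andP[t0 tp].
have -> : F 0 = 1.
  rewrite /F subr0 powR1 mulr1 /S horner_sum big_ord_recl big1 ?addr0.
    by rewrite !hornerE /c /binr big_ord0 fact0 divr1.
  by move=> i _; rewrite !hornerE expr0n mulr0.
have -> : F (1 - p) = \sum_(k < n.+1) law_pmf (NegBinomial r p) k%:Z.
  rewrite /F (_ : 1 - (1 - p) = p); last by ring.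
  rewrite /S horner_sum mulr_suml; apply: eq_bigr => i _ /=.
  by rewrite !hornerE /c; ring.
rewrite distrC => ->.
have c0 : 0 < c n.+1 by exact: binr_rising_gt0.
have pr : 0 < p `^ r by exact: powR_gt0.
rewrite /f 2!normrM normrN 2!normrM.
rewrite (ger0_norm (powR_ge0 _ _)) (gtr0_norm c0) normrX (gtr0_norm t0).
rewrite normr_nat gtr0_norm ?subr_gt0 //.
rewrite /= -pmulrn -/(c n.+1).
(* The bound is now compared factor by factor: t^n with (1 - p)^n, (1 - t)^(r - 1) with 1 / p, and
   the interval length 1 - p with itself. *)
rewrite (_ : _ / p `^ r = n.+1%:R * c n.+1 * (1 - p) ^+ n * p^-1 * (1 - p)).
  rewrite ler_wpM2r //; first by rewrite subr_ge0 ltW.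
  have nc0 : 0 <= n.+1%:R * c n.+1 by rewrite mulr_ge0 // ltW.
  apply: ler_pM; first by rewrite mulr_ge0 // exprn_ge0 // ltW.
  - exact: powR_ge0.
  - by rewrite ler_wpM2l // lerXn2r ?nnegrE ?(ltW t0) ?(ltW tp) // subr_ge0 ltW.
  (* Dividing (1 - t)^r <= 1 by 1 - t >= p treats r < 1 and r >= 1 alike. *)
  rewrite powRB; last by apply/implyP => _; rewrite subr_eq0 gt_eqF //; lra.
  rewrite powRr1; last lra.
  have pt : p <= 1 - t by lra.
  have le1 : (1 - t) `^ r <= 1.
    rewrite [leRHS](_ : 1 = 1 `^ r); last by rewrite powR1.
    by apply: ge0_ler_powR; rewrite ?nnegrE; lra.
  rewrite ler_pdivrMr; last lra.
  by rewrite (le_trans le1) // mulrC ler_pdivlMr // mul1r.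
by rewrite exprS; field; rewrite !gt_eqF.
Qed.

Lemma sum_law_pmf_cvg1 (R : realType) (L : law R) : law_valid L ->
  series (fun k : nat => law_pmf L k%:Z) @ \oo --> (1 : R).
Proof.
move=> hL; have fin N : (forall k, (N < k)%N -> law_pmf L k%:Z = 0) ->
    \sum_(k < N.+1) law_pmf L k%:Z = 1 ->
    series (fun k : nat => law_pmf L k%:Z) @ \oo --> (1 : R).
  move=> L0 L1; apply: (@cvg_eventually_eq _ _ _ N.+1) => n Nn.
  rewrite /series /= (big_cat_nat (n := N.+1)) //= big_mkord L1.
  by rewrite big_nat_cond big1 ?addr0 // => i /andP[/andP[Ni _] _]; exact: L0.
case: L hL fin => [N p [_ /andP[p0 p1]]|l l0|r p hL|N K n hL] fin.
- apply: (fin N) => [k Nk|]; first by rewrite /= /binomial_pmf bin_small.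
  transitivity (((1 - p) + p) ^+ N); last by rewrite subrK expr1n.
  rewrite exprDn; apply: eq_bigr => i _.
  by rewrite /= /binomial_pmf mulrC.
- have -> : series (fun k : nat => law_pmf (Poisson l) k%:Z) =
      (fun n => expR (- l) * series (exp_coeff l) n).
    apply/funext => n /=; rewrite /series /= mulr_sumr.
    apply: eq_bigr => i _; rewrite /poisson_pmf /exp_coeff /= ifT; first by ring.
    exact: l0.
  rewrite -(expRxMexpNx_1 l) mulrC; apply: cvgMr.
  exact: is_cvg_series_exp_coeff.
- have [r0 p01] := hL.
  apply/cvgrPdist_le => /= e e0.
  have [p0 _] := andP p01.
  have pr : 0 < p `^ r by exact: powR_gt0.
  (* The error of the partial mass is at most the boundary term over p^r, so the decay of that term
     suffices, with tolerance e p^r. *)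
  have h := law_g_pmf_cvg0 R _ hL.
  have /cvgrPdist_le /(_ (e * p `^ r)) h' := h.
  have := h' (mulr_gt0 e0 pr).
  move=> [N _ HN]; exists N.+1 => // -[//|n] /= Nn.
  rewrite /series /= big_mkord.
  rewrite (le_trans (negbinomial_partial_mass _ _ _ n r0 p01)) //.
  rewrite ler_pdivrMr //; apply: le_trans (HN n.+1 (ltnW Nn)).
  by rewrite sub0r normrN ler_norm.
- have [/andP[K0 KN] /andP[n0 nN]] := hL.
  apply: (fin n) => [k nk|] /=.
    by rewrite (_ : n%:Z - k%:Z = Negz (k - n).-1) ?mulr0 ?mul0r //; lia.
  rewrite -mulr_suml (_ : \sum_(i < n.+1) _ = 'C(N, n)%:R).
    by rewrite divff // pnatr_eq0 -lt0n bin_gt0; lia.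
  rewrite -[N in RHS](@subnKC K); last lia.
  rewrite -binomial.Vandermonde natr_sum; apply: eq_bigr => i _.
  by rewrite subzn /= ?natrM // -ltnS.
Qed.

(** * Expectations from the masses at the natural numbers *)

(** The events X = k are disjoint with total probability 1, so the complement of their union is null
    and the integral splits over them. *)
Lemma expectation_nat_support (R : realType) (d : measure_display)
    (T : measurableType d) (Pr : probability T R) (X : {RV Pr >-> R})
    (p : R^nat) (f : R -> R) (l : R) :
  (forall k : nat, pmf X k%:R = p k) -> series p @ \oo --> (1 : R) ->
  measurable_fun setT f -> (forall k : nat, 0 <= f k%:R) ->
  (fun n => \sum_(0 <= k < n) f k%:R * p k) @ \oo --> l ->
  'E_Pr[f \o X]%E = l%:E.
Proof.
move=> Xp p1 mf f0 fl.
pose A k := X @^-1` [set k%:R : R].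
have mA k : measurable (A k).
  by rewrite -[A k]setTI; apply: measurable_funP.
have PA k : Pr (A k) = (p k)%:E.
  by rewrite -Xp /pmf fineK // fin_num_measure.
have tA : trivIset setT A.
  by move=> i j _ _ [t []]; rewrite /A /= => -> /eqP; rewrite eqr_nat => /eqP.
pose D := \bigcup_k A k.
have mD : measurable D by exact: bigcup_measurable.
have PD : Pr (~` D) = 0%E.
  rewrite probability_setC // (_ : Pr D = 1%E) ?subee //.
  rewrite (measure_semi_bigcup _ mA tA mD) (eq_eseriesr (fun i _ => PA i)).
  apply/cvg_lim => //; under eq_fun do rewrite sumEFin.
  by apply: cvg_EFin => //; exact: nearW.
have mfX : measurable_fun setT (f \o X) by exact: measurableT_comp.
have mN : measurable (~` D) by exact: measurableC.
have mfX' : measurable_fun setT (fun t => `|f (X t)|) by exact: measurableT_comp.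
(* f may be negative away from the naturals; passing to its absolute value changes nothing on [D]
   and allows countable additivity of nonnegative integrals. *)
rewrite unlock (ae_eq_integral (fun t => `|f (X t)|%:E)) //=; first last.
- exists (~` D); split => // t /= nt Dt; apply: nt => _.
  by case: Dt => k _ /= ->; rewrite ger0_norm.
- exact/measurable_realfun.measurable_EFinP.
- exact/measurable_realfun.measurable_EFinP.
rewrite (ge0_negligible_integral mN) //=; last first.
  exact/measurable_realfun.measurable_EFinP.
rewrite setTD setCK.
rewrite ge0_integral_bigcup //=; last first.
  by apply: measurable_funS (measurableT) _ _ => //;
    exact/measurable_realfun.measurable_EFinP.
transitivity (\sum_(i <oo) (f i%:R * p i)%:E)%E.
  apply: eq_eseriesr => i _.
  rewrite (eq_integral (cst (f i%:R)%:E)).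
    by rewrite EFinM -(PA i); exact: integral_cst.
  by move=> t; rewrite inE => -> /=; rewrite ger0_norm.
apply/cvg_lim => //; under eq_fun do rewrite sumEFin.
by apply: cvg_EFin => //; exact: nearW.
Qed.

(** * Telescoped sums and moments *)

Section stein_recursion.
Context {R : realType} (p g : R^nat) (mu : R) (g0 : g 0 = 0)
  (rec : forall k, (k%:R - mu) * p k = g k * p k - g k.+1 * p k.+1)
  (gp0 : (fun n => g n * p n) @ \oo --> 0).

Lemma sum_centered nu n : (nu <= n)%N ->
  \sum_(nu <= k < n) (k%:R - mu) * p k = g nu * p nu - g n * p n.
Proof.
move=> nun; rewrite -[LHS]opprK -sumrN.
rewrite (eq_bigr (fun k => g k.+1 * p k.+1 - g k * p k)).
  by rewrite (telescope_sumr (fun k => g k * p k)) // opprB.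
by move=> k _; rewrite rec opprB.
Qed.

Lemma sum_centered_cvg nu :
  (fun n => \sum_(nu <= k < n) (k%:R - mu) * p k) @ \oo --> g nu * p nu.
Proof.
apply: (@cvg_trans _ ((fun n => g nu * p nu - g n * p n) @ \oo)).
  by apply: near_eq_cvg; exists nu => // n /= nun; rewrite sum_centered.
have := cvgB (cvg_cst (g nu * p nu)) gp0; rewrite subr0; exact.
Qed.

(** Write k = (k - mu) + mu: the centered sum from 0 tends to g(0) p(0) = 0, and the remaining part
    is mu times the total mass. *)
Lemma first_moment_cvg : series p @ \oo --> (1 : R) ->
  (fun n => \sum_(0 <= k < n) k%:R * p k) @ \oo --> mu.
Proof.
move=> p1.
rewrite (_ : (fun n => _) =
  (fun n => \sum_(0 <= k < n) (k%:R - mu) * p k + mu * series p n)).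
  have := cvgD (sum_centered_cvg 0) (cvgMl_tmp (a := mu) p1).
  by rewrite g0 mul0r add0r mulr1; exact.
apply/funext => n; rewrite /series /= mulr_sumr -big_split /=.
by apply: eq_bigr => k _; ring.
Qed.

(** Since g(0) = 0, the centered sum below nu is - g(nu) p(nu), while the sum from nu on tends to
    g(nu) p(nu). The absolute value flips the first sign, whence the factor 2. *)
Lemma abs_centered_moment_cvg nu :
  (forall k, (k < nu)%N -> k%:R <= mu) ->
  (forall k, (nu <= k)%N -> mu <= k%:R) ->
  (fun n => \sum_(0 <= k < n) `|k%:R - mu| * p k) @ \oo --> 2 * g nu * p nu.
Proof.
move=> lemu gemu.
rewrite (_ : 2 * _ * _ = g nu * p nu + g nu * p nu); last by ring.
apply: (@cvg_trans _
  ((fun n => g nu * p nu + \sum_(nu <= k < n) (k%:R - mu) * p k) @ \oo)).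
  apply: near_eq_cvg; exists nu => // n /= nun.
  rewrite [RHS](big_cat_nat (n := nu)) //=; congr (_ + _).
    transitivity (- \sum_(0 <= k < nu) (k%:R - mu) * p k).
      by rewrite sum_centered // g0 mul0r sub0r opprK.
    rewrite -sumrN; apply: eq_big_nat => k /andP[_ kn].
    by rewrite ler0_norm ?subr_le0 ?lemu // mulNr.
  apply: eq_big_nat => k /andP[nuk _].
  by rewrite ger0_norm // subr_ge0 gemu.
by apply: cvgD; [exact: cvg_cst | exact: sum_centered_cvg].
Qed.

End stein_recursion.

Theorem theorem3p1 (R : realType) (d : measure_display) (T : measurableType d)
    (Pr : probability T R) (X : {RV Pr >-> R}) (L : law R)
    (hL : law_valid L)
    (hX : forall k : int, pmf X k%:~R = law_pmf L k) :
  let P := fun k : int => pmf X k%:~R in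
  let mu := law_mean L in
  let g := law_g L in
  [/\ 'E_Pr[X]%E = mu%:E,
      (forall k : int, 0 <= k ->
         (k%:~R - mu) * P k = g k * P k - g (k + 1) * P (k + 1)),
      (forall nu : nat,
         (fun n : nat => \sum_(nu <= k < n) (k%:R - mu) * P k%:Z) @ \oo
           --> g nu%:Z * P nu%:Z),
      (let nu := Num.ceil mu in
       'E_Pr[(fun t => `|X t - mu|)%R]%E = (2 * g nu * P nu)%:E)
    & (forall m : int, mu = m%:~R ->
         'E_Pr[(fun t => `|X t - mu|)%R]%E = (2 * g m * P m)%:E /\
         'E_Pr[(fun t => `|X t - mu|)%R]%E = (2 * g (m + 1) * P (m + 1))%:E)].
Proof.
move=> P mu g.
have PE k : P k = law_pmf L k by exact: hX.
have Sk (k : nat) : (k%:R - mu) * P k%:Z = g k%:Z * P k%:Z - g k.+1%:Z * P k.+1%:Z.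
  by rewrite !PE [g k.+1%:Z * _]law_g_pmfS // /mu /g; ring.
have g0 : g 0%:Z = 0.
  by rewrite /g; case: (L) => *; rewrite /= ?mul0r.
have gP0 : (fun n : nat => g n%:Z * P n%:Z) @ \oo --> 0.
  by under eq_fun do rewrite PE; exact: law_g_pmf_cvg0.
have P1 : series (fun k : nat => P k%:Z) @ \oo --> (1 : R).
  by under [X in series X]eq_fun do rewrite PE; exact: sum_law_pmf_cvg1.
(* This makes the ceiling of mu a natural number and rules out a negative integer value of mu. *)
have mu0 : 0 <= mu.
  rewrite /mu; case: (L) hL => [N p [_ /andP[/ltW p0 _]]|l /ltW //|r p|N K n _] /=.
  - by rewrite mulr_ge0.
  - move=> [/ltW r0 /andP[/ltW p0 /ltW p1]].
    by rewrite divr_ge0 // mulr_ge0 // subr_ge0.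
  - by rewrite divr_ge0 // mulr_ge0.
have EX (f : R -> R) (l : R) : measurable_fun setT f ->
    (forall k : nat, 0 <= f k%:R) ->
    (fun n => \sum_(0 <= k < n) f k%:R * P k%:Z) @ \oo --> l ->
    'E_Pr[f \o X]%E = l%:E.
  by apply: expectation_nat_support => // k.
(* Both inequalities with mu are weak, so that for an integer mu the choices mu and mu + 1 both
   qualify. *)
have Eabs (nu : nat) : (forall k, (k < nu)%N -> k%:R <= mu) ->
    (forall k, (nu <= k)%N -> mu <= k%:R) ->
    'E_Pr[(fun t => `|X t - mu|)%R]%E = (2 * g nu%:Z * P nu%:Z)%:E.
  move=> lemu gemu; apply: (EX (fun x => `|x - mu|)) => //.
    by apply: measurableT_comp => //; exact: measurable_realfun.measurable_funB.
  exact: (@abs_centered_moment_cvg _ (fun k : nat => P k%:Z)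
    (fun k : nat => g k%:Z)).
split.
- apply: (EX id) => //.
  exact: (@first_moment_cvg _ (fun k : nat => P k%:Z) (fun k : nat => g k%:Z)).
- case=> // k _.
  by rewrite (_ : k%:Z + 1 = k.+1%:Z); [exact: Sk | lia].
- exact: (@sum_centered_cvg _ (fun k : nat => P k%:Z) (fun k : nat => g k%:Z)).
- have cmu := ceil_ge mu.
  have cmu1 := ceilB1_lt mu.
  move=> nu; rewrite /nu.
  have : 0 <= Num.ceil mu by rewrite ceil_ge0; lra.
  move: cmu cmu1; case: (Num.ceil mu) => // n cmu cmu1 _.
  rewrite intrB -pmulrn in cmu1; rewrite -pmulrn in cmu.
  apply: Eabs => k kn.
  + have : (k.+1%:R : R) <= n%:R by rewrite ler_nat.
    by rewrite -natr1; lra.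
  + by rewrite (le_trans cmu) // ler_nat.
- case=> m mum; last first.
    have : (0 : R) <= (Negz m)%:~R by rewrite -mum.
    by rewrite ler0z.
  rewrite -pmulrn in mum.
  split; first by apply: Eabs => k km; rewrite mum ler_nat // ltnW.
  rewrite (_ : m%:Z + 1 = m.+1%:Z); last lia.
  by apply: Eabs => k km; rewrite mum ler_nat // ltnW.
Qed.
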